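(* Let $\mathcal{H}$ be a complex Hilbert space and let $T\in\mathcal{B}(\mathcal{H})$. Then for all $\alpha\in[0,1]$, $$w^2(T)\leq\frac{\alpha}{4}w^2(|T|+i|T^*|)+\frac{\alpha}{4}w(|T||T^*|)+\min\left\{\left\|\left(1-\frac{7\alpha}{8}\right)|T^*|^2+\frac{\alpha}{8}|T|^2\right\|,\ \left\|\left(1-\frac{7\alpha}{8}\right)|T|^2+\frac{\alpha}{8}|T^*|^2\right\|\right\}.$$
   Context: $\mathcal{B}(\mathcal{H})$ denotes the $C^*$-algebra of all bounded linear operators on the complex Hilbert space $\mathcal{H}$, and $\|\cdot\|$ is the operator norm. For $T\in\mathcal{B}(\mathcal{H})$, $|T|=(T^*T)^{1/2}$ and $|T^*|=(TT^* )^{1/2}$. The numerical radius is $w(T)=\sup\{|\langle Tx,x\rangle|: x\in\mathcal{H},\ \|x\|=1\}$, and $w^2(\cdot)=(w(\cdot))^2$. *)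

(* Defs.v *)
From HB Require Import structures.
From mathcomp Require Import all_boot all_order all_algebra.
From mathcomp Require Import complex.
From mathcomp Require Import boolp classical_sets functions reals.
From mathcomp Require Import topology normedtype.

Set Implicit Arguments.
Unset Strict Implicit.
Unset Printing Implicit Defensive.

Import Order.TTheory GRing.Theory Num.Theory.
Import numFieldNormedType.Exports.

Local Open Scope classical_set_scope.
Local Open Scope ring_scope.
Local Open Scope complex_scope.

(* [inner] is linear in its first argument and conjugate-linear in the second. *)
HB.mixin Record isHilbert (R : realType) H
    of CompleteNormedModule R[i] H := {
  inner : {dot H for Num.conj};
  inner_norm : forall x : H, `|x| ^+ 2 = inner x x }.

#[short(type="hilbertType")]
HB.structure Definition Hilbert (R : realType) :=
  { H of CompleteNormedModule R[i] H & isHilbert R H }.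

Section Operators.
Context {R : realType} {H : hilbertType R}.
Implicit Types A B S T : H -> H.

Definition bounded_operator T : Prop :=
  linear T /\ exists M : R, forall x : H, `|T x| <= M%:C * `|x|.

Definition positive_operator A : Prop :=
  bounded_operator A /\ forall x : H, 0 <= inner (A x) x.

(* Norms over [R[i]] take their (real) values in [R[i]], hence the real part. *)
Definition opnorm T : R := sup [set complex.Re `|T x| | x in [set x : H | `|x| <= 1]].

(* [sup set0 = 0], so the numerical radius is 0 on the zero space. *)
Definition numradius T : R :=
  sup [set complex.Re `|inner (T x) x| | x in [set x : H | `|x| = 1]].

(* For bounded [T] (resp. positive [A]) the sets below are singletons; the
   default value 0 is only taken on other arguments. *)
Definition adjoint T : H -> H :=
  xget 0 [set S | bounded_operator S /\
                  forall x y : H, inner (T x) y = inner x (S y)].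

Definition sqrt_operator A : H -> H :=
  xget 0 [set B | positive_operator B /\ B \o B = A].

Definition abs_operator T : H -> H := sqrt_operator (adjoint T \o T).

End Operators.

(* Main.v *)
(* Put A = |T| and B = |S|, S the adjoint of T. Mixed Schwarz gives |<Tx,x>|^2 <= ab for a unit
   vector x, with a = <Ax,x> and b = <Bx,x>, while
   4ab <= (a^2 + b^2) + 2ab, where a^2 + b^2 = |<(A + iB)x,x>|^2 and, by Buzano,
   2ab <= |<ABx,x>| + |Ax||Bx| <= |<ABx,x>| + (|Ax|^2 + |Bx|^2)/2.
   Weight the resulting bound by alpha, and |<Tx,x>|^2 <= |Bx|^2 (resp. |Ax|^2)
   by 1 - alpha.
   Mixed Schwarz rests on TA = BT: square roots are limits of polynomials, hence
   they inherit the relation T(ST) = (TS)T. For x = Au it is Cauchy-Schwarz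
   for the form <B.,.>; the general case follows since, modulo ker A = ker T,
   the range of A is dense. *)
Require Import Defs.
From HB Require Import structures.
From mathcomp Require Import all_boot all_order all_algebra.
From mathcomp Require Import complex.
From mathcomp Require Import boolp classical_sets functions reals.
From mathcomp Require Import topology normedtype.
From mathcomp Require Import ring lra.

Import Order.TTheory GRing.Theory Num.Theory.
Import numFieldNormedType.Exports.

Local Open Scope ring_scope.
Local Open Scope complex_scope.

(** * The real part of the inner product and the real-valued norm *)

Section RealInner.
Context {R : realType} {H : hilbertType R}.
Implicit Types x y z : H.

(** Order arguments run over the real field through [rip] and [nm]; imaginary parts are recovered by
    testing at ['i *: x], moduli by [phase]. *)
Definition rip x y : R := complex.Re (inner x y).
Definition nm x : R := complex.Re `|x|.

Lemma nmE x : `|x| = (nm x)%:C.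
Proof. by rewrite /nm RRe_real // ger0_real. Qed.

Lemma nm_ge0 x : 0 <= nm x.
Proof. by rewrite -ler0c -nmE. Qed.

Lemma nm_sqr x : nm x ^+ 2 = rip x x.
Proof. by rewrite /rip -inner_norm nmE -rmorphXn. Qed.

Lemma nmD x y : nm (x + y) <= nm x + nm y.
Proof. by rewrite -lecR rmorphD /= -!nmE ler_normD. Qed.

Lemma nm0_eq0 x : nm x = 0 -> x = 0.
Proof. by move=> h; apply/eqP; rewrite -normr_eq0 nmE h. Qed.

Lemma innerC x y : inner x y = conjc (inner y x).
Proof. by rewrite (hermC (@inner R H)) expr0 mul1r. Qed.

Lemma ripC x y : rip x y = rip y x.
Proof. by rewrite /rip innerC; case: (inner y x). Qed.
Lemma ripDl x y z : rip (x + y) z = rip x z + rip y z.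
Proof. by rewrite /rip linearDl raddfD. Qed.
Lemma ripZl (a : R) x y : rip (a%:C *: x) y = a * rip x y.
Proof. by rewrite /rip linearZl_LR /=; case: (inner x y) => u v /=; rewrite mul0r subr0. Qed.
Lemma ripNl x y : rip (- x) y = - rip x y.
Proof. by rewrite /rip linearNl raddfN. Qed.
Lemma ripDr x y z : rip x (y + z) = rip x y + rip x z.
Proof. by rewrite ripC ripDl !(ripC x). Qed.
Lemma ripNr x y : rip x (- y) = - rip x y.
Proof. by rewrite ripC ripNl ripC. Qed.
Lemma ripZr (a : R) x y : rip x (a%:C *: y) = a * rip x y.
Proof. by rewrite ripC ripZl ripC. Qed.
Lemma ripil x y : rip ('i *: x) y = - complex.Im (inner x y).
Proof. by rewrite /rip linearZl_LR /=; case: (inner x y) => u v /=; rewrite mul0r mul1r sub0r. Qed.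

Definition ripE := (ripDl, ripDr, ripNl, ripNr, ripZl, ripZr).

Lemma nmN x : nm (- x) = nm x.
Proof. by rewrite /nm normrN. Qed.
Lemma nmZ (a : R) x : nm (a%:C *: x) = `|a| * nm x.
Proof. 
by apply: complexI; rewrite -nmE normrZ rmorphM /= -nmE normc_def /= expr0n /= addr0 sqrtr_sqr.
Qed.
Lemma nmB x y : nm (x - y) = nm (y - x).
Proof. by rewrite -nmN opprB. Qed.
Lemma nm0 : nm 0 = 0.
Proof. by rewrite /nm normr0. Qed.

(** The hypothesis is tested at the vertex t = -b/c. If c = 0 the function is affine in t, and its
    value -1 at t = -(a + 1)/(2b) excludes a nonzero b. *)
Lemma quadratic_disc (a b c : R) : 0 <= c ->
  (forall t : R, 0 <= a + 2 * t * b + t ^+ 2 * c) -> b ^+ 2 <= a * c.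
Proof.
move=> c0 h; have [c1|c1] := eqVneq c 0.
  have [->|b0] := eqVneq b 0; first by rewrite c1; lra.
  have := h (- (a + 1) / (2 * b)); rewrite c1 mulr0 addr0.
  have -> : a + 2 * (- (a + 1) / (2 * b)) * b = -1 by field.
  lra.
have cp : 0 < c by rewrite lt_def c1.
have := h (- b / c).
have -> : a + 2 * (- b / c) * b + (- b / c) ^+ 2 * c = (a * c - b ^+ 2) / c by field.
by rewrite pmulr_lge0 ?invr_gt0 // subr_ge0.
Qed.

Lemma rip_ext x y : (forall z, rip z x = rip z y) -> x = y.
Proof.
move=> h; apply/eqP; rewrite -subr_eq0; apply/eqP/nm0_eq0/eqP.
rewrite -sqrf_eq0 nm_sqr ripDr ripNr h subrr //.
Qed.
End RealInner.

(** * Bounded, symmetric and positive operators *)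

Section Operators.
Context {R : realType} {H : hilbertType R}.
Implicit Types (x y z : H) (A B S T : H -> H).

Section LinearFun.
Variables (T : H -> H) (lT : linear T).
Lemma linD x y : T (x + y) = T x + T y.
Proof. by rewrite -{1}(scale1r x) lT scale1r. Qed.
Lemma lin0 : T 0 = 0.
Proof. by apply: (@addrI _ (T 0)); rewrite -linD !addr0. Qed.
Lemma linZ (a : R[i]) x : T (a *: x) = a *: T x.
Proof. by rewrite -[a *: x]addr0 lT lin0 addr0. Qed.
Lemma linN x : T (- x) = - T x.
Proof. by rewrite -scaleN1r linZ scaleN1r. Qed.
Lemma linB x y : T (x - y) = T x - T y.
Proof. by rewrite linD linN. Qed.
End LinearFun.

Lemma bounded_opP T : bounded_operator T <->
  linear T /\ exists M : R, 0 < M /\ forall x, nm (T x) <= M * nm x.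
Proof.
split=> [[lT [M hM]]|[lT [M [M0 hM]]]]; split=> //.
  exists (Num.max 1 M); split; first by rewrite lt_max ltr01.
  move=> x; have := hM x; rewrite !nmE -rmorphM lecR => /le_trans; apply.
  by rewrite ler_wpM2r ?nm_ge0 // le_max lexx orbT.
by exists M => x; rewrite !nmE -rmorphM lecR.
Qed.

Definition sym A := forall x y, rip (A x) y = rip x (A y).

Lemma positive_opP A : positive_operator A <->
  [/\ bounded_operator A, sym A & forall x, 0 <= rip (A x) x].
Proof.
split=> [[bA pA]|[bA sA pA]].
  have [lA _] := bA; split=> // [x y|x]; last first.
    by have := pA x; rewrite lecE => /andP[].
  have im0 z : complex.Im (inner (A z) z) = 0 by exact: ger0_Im.
  (* Polarization: the imaginary part of the form at x + iy is Re <Ay,x> - Re <Ax,y>, and it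
     vanishes. *)
  have := im0 (x + 'i *: y).
  have -> : inner (A (x + 'i *: y)) (x + 'i *: y) = inner (A x) x + inner (A y) y
     - 'i * inner (A x) y + 'i * inner (A y) x.
    rewrite linD // linZ // !linearDl !linearDr !linearZl_LR !linearZr_LR /= .
    have -> : (Num.conj_op ('i : R[i])) = - 'i.
      by apply/eqP; rewrite eq_complex /= oppr0 !eqxx.
    have -> : 'i * (- 'i * inner (A y) y) = inner (A y) y.
      by rewrite mulNr mulrN mulrA -expr2 sqr_i mulN1r opprK.
    ring.
  rewrite !raddfD /= !im0 raddfN /= (ripC x) /rip.
  by case: (inner (A x) y) => a b; case: (inner (A y) x) => c d /=; lra.
split=> // x; rewrite lecE /= -/(rip (A x) x) pA andbT; apply/eqP.
(* Symmetry of the real part at the pair (ix, x) reads Im <Ax,x> = - Im <Ax,x>. *)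
have := sA ('i *: x) x; rewrite linZ ?bA.1 //; last by have [] := bA.
rewrite !ripil (innerC x).
by case: (inner (A x) x) => a b /=; lra.
Qed.

(** The discriminant argument for the possibly degenerate form <A.,.>; A = id gives Cauchy-Schwarz
    itself. *)
Lemma pos_cs A x y : linear A -> sym A -> (forall x, 0 <= rip (A x) x) ->
  rip (A x) y ^+ 2 <= rip (A x) x * rip (A y) y.
Proof.
move=> lA sA pA; apply: quadratic_disc => // t.
have := pA (x + t%:C *: y).
rewrite linD // linZ // !ripE (ripC (A y) x) -sA; lra.
Qed.

Lemma rip_cs x y : rip x y ^+ 2 <= nm x ^+ 2 * nm y ^+ 2.
Proof. by rewrite !nm_sqr; apply: (@pos_cs id) => // z; rewrite -nm_sqr sqr_ge0. Qed.

Lemma rip_le x y : rip x y <= nm x * nm y.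
Proof.
apply: le_trans (ler_norm _) _.
rewrite -(@ler_pXn2r _ 2) ?nnegrE ?mulr_ge0 ?nm_ge0 //.
by rewrite real_normK ?num_real // exprMn rip_cs.
Qed.

Definition cmod (z : R[i]) : R := complex.Re `|z|.

Lemma cmod_ge0 (z : R[i]) : 0 <= cmod z.
Proof. by rewrite -ler0c /cmod RRe_real ?ger0_real. Qed.

(* Multiplying by a unimodular scalar makes the inner product real. *)
Lemma phase x y : exists c : R[i],
  `|c| = 1 /\ rip x (c *: y) = cmod (inner x y).
Proof.
have [h|h] := eqVneq (inner x y) 0.
  by exists 1; rewrite normr1 scale1r /cmod /rip h normr0.
exists (inner x y / `|inner x y|); split.
  by rewrite normrM normfV normr_id divff // normr_eq0.
rewrite /cmod /rip linearZr_LR /= rmorphM fmorphV /= conj_normC mulrAC.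
by rewrite [_^* * _]mulrC -normCK expr2 mulfK // normr_eq0.
Qed.


Lemma nm_phase (c : R[i]) x : `|c| = 1 -> nm (c *: x) = nm x.
Proof. by move=> hc; rewrite /nm normrZ hc mul1r. Qed.

Lemma rip_phase (c : R[i]) x y : `|c| = 1 -> rip (c *: x) (c *: y) = rip x y.
Proof.
move=> hc; rewrite /rip linearZl_LR linearZr_LR /= mulrA -normCK hc.
by rewrite expr1n mul1r.
Qed.

Lemma cmod_le x y : cmod (inner x y) <= nm x * nm y.
Proof. by have [c [hc <-]] := phase x y; rewrite -(nm_phase c y hc) rip_le. Qed.

(** * Limits with an explicit rate c/(n+1) *)

Lemma archi_lt (c e : R) : 0 < e -> exists n, c / n.+1%:R < e.
Proof.
move=> e0; exists (Num.bound (c / e)).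
rewrite ltr_pdivrMr ?ltr0n // mulrC -ltr_pdivrMr //.
by apply: lt_trans (unstable.ltr_bound _) _; rewrite ltr_nat.
Qed.

Lemma le_of_archi (x y c : R) : (forall n, x <= y + c / n.+1%:R) -> x <= y.
Proof.
move=> h; apply/ler_addgt0Pr => e /(archi_lt c e)[n hn].
by apply: le_trans (h n) _; rewrite lerD2l ltW.
Qed.

(** This is where completeness of H enters. Letting m tend to infinity in the hypothesis, the limit
    keeps the same rate. *)
Lemma cauchy_rate_lim (u : nat -> H) (c : R) :
  (forall n m, (n <= m)%N -> nm (u m - u n) <= c / n.+1%:R) ->
  exists l, forall n, nm (l - u n) <= c / n.+1%:R.
Proof.
move=> hu.
have cu : cauchy (u @ \oo)%classic.
  (* A positive e in [R[i]] has zero imaginary part, so its real part serves as the radius. *)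
  apply: cauchy_exP => e; rewrite ltcE /= => /andP[/eqP ei er].
  have [n hn] := archi_lt c _ er.
  exists (u n); exists n => // m /= nm_; rewrite -ball_normE /=.
  rewrite nmE nmB ltcE /= ei eqxx /=.
  exact: le_lt_trans (hu _ _ nm_) hn.
have [l hl] := (cvg_ex _).1 (cauchy_cvg _ cu).
exists l => n; apply/ler_addgt0Pr => e e0.
have he : 0 < e%:C by rewrite ltcR.
have [m _ hm] := (@cvgrPdist_lt _ _ _ _ _ _ _).1 hl _ he.
have := hm (maxn n m) (leq_maxr _ _).
rewrite /= nmE ltcR => h1.
have -> : l - u n = (u (maxn n m) - u n) + (l - u (maxn n m)).
  by rewrite [RHS]addrC addrA subrK.
apply: le_trans (nmD _ _) (lerD (hu _ _ (leq_maxl _ _)) (ltW h1)).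
Qed.

(** * Riesz representation and adjoints *)

Lemma parallelogram x y :
  nm (x + y) ^+ 2 + nm (x - y) ^+ 2 = 2 * (nm x ^+ 2 + nm y ^+ 2).
Proof. by rewrite !nm_sqr !ripE; ring. Qed.

(* The representing vector minimizes |z|^2 - 2 f(z); a minimizing sequence is
   Cauchy by the parallelogram identity. *)
Lemma riesz (f : H -> R) (M : R) :
  (forall x y, f (x + y) = f x + f y) ->
  (forall (a : R) x, f (a%:C *: x) = a * f x) ->
  (forall x, f x <= M * nm x) -> exists w, forall h, f h = rip h w.
Proof.
move=> fD fZ fM.
pose J z := nm z ^+ 2 - 2 * f z.
have Jlow z : - M ^+ 2 <= J z.
  by rewrite /J; have := fM z; have := sqr_ge0 (nm z - M); nra.
pose E : set R := [set J z | z in [set: H]]%classic.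
have hE : has_inf E.
  split; first by exists (J 0); exists 0.
  by exists (- M ^+ 2) => _ [z _ <-].
pose m := inf E.
have mJ z : m <= J z by apply: ge_inf; [exact: hE.2|exists z].
(* The error is squared because the parallelogram identity controls squared distances: |u k - u n|^2
   <= 4/(n+1)^2 for n <= k. *)
have /choice[u hu] : forall n, exists z, J z <= m + (n.+1%:R^-1) ^+ 2.
  move=> n; have [] := @inf_adherent _ E ((n.+1%:R^-1) ^+ 2) _ hE.
    by rewrite exprn_gt0 // invr_gt0 ltr0n.
  by move=> _ [z _ <-] /ltW hz; exists z.
have half z : f (2^-1%:C *: z) = 2^-1 * f z by exact: fZ.
have [w hw] : exists w, forall n, nm (w - u n) <= 2 / n.+1%:R.
  apply: cauchy_rate_lim => n k nk.
  rewrite -(@ler_pXn2r _ 2) ?nnegrE ?nm_ge0 ?divr_ge0 //.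
  have := hu n; have := hu k; have := mJ (2^-1%:C *: (u k + u n)).
  rewrite {1}/J nmZ half fD exprMn real_normK ?num_real // /J.
  have := parallelogram (u k) (u n).
  have : (k.+1%:R^-1 : R) ^+ 2 <= n.+1%:R^-1 ^+ 2.
    by rewrite ler_pXn2r ?nnegrE ?invr_ge0 // lef_pV2 ?posrE ?ltr0n // ler_nat.
  rewrite exprMn.
  move: (n.+1%:R^-1 ^+ 2) (k.+1%:R^-1 ^+ 2) (nm _ ^+ 2) (nm _ ^+ 2) (nm _ ^+ 2) (nm _ ^+ 2).
  by move=> e1 e2 a1 a2 a3 a4; lra.
exists w => h.
(* This is J(w + th) - J(w) >= 0, obtained from the [u n] up to O(1/(n+1)). As its constant term is
   0, the discriminant bound forces the linear coefficient to vanish. *)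
have key t : 0 <= 0 + 2 * t * (rip h w - f h) + t ^+ 2 * nm h ^+ 2.
  apply: (@le_of_archi _ _ (1 + 4 * `|t| * nm h)) => n.
  have := mJ (u n + t%:C *: h); have := hu n.
  rewrite /J fD fZ !nm_sqr !ripE -!nm_sqr (ripC h (u n)).
  have -> : rip (u n) h = rip h w - rip (w - u n) h by rewrite !ripE (ripC w); ring.

  set r := rip (w - u n) h.
  have : - (t * r) <= `|t| * (2 / n.+1%:R * nm h).
    apply: le_trans (ler_norm _) _; rewrite normrN normrM ler_wpM2l //.
    rewrite -(@ler_pXn2r _ 2) ?nnegrE ?mulr_ge0 ?nm_ge0 ?invr_ge0 //.
    rewrite real_normK ?num_real //.
    apply: le_trans (rip_cs _ _) _; rewrite exprMn ler_wpM2r ?sqr_ge0 //.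
    by rewrite ler_pXn2r ?nnegrE ?nm_ge0 ?divr_ge0.
  have : (n.+1%:R^-1 : R) ^+ 2 <= n.+1%:R^-1.
    by rewrite expr2 ler_piMl ?invr_ge0 // invf_le1 ?ltr0n // ler1n.
  move: (n.+1%:R^-1) => k; lra.
have := quadratic_disc _ _ _ (sqr_ge0 _) key; rewrite mul0r => h0.
have /eqP : (rip h w - f h) ^+ 2 = 0 by apply/eqP; rewrite eq_le h0 sqr_ge0.
by rewrite sqrf_eq0 subr_eq0 => /eqP.
Qed.

Lemma bounded_comp A B :
  bounded_operator A -> bounded_operator B -> bounded_operator (A \o B).
Proof.
move=> /bounded_opP[lA [M [M0 hM]]] /bounded_opP[lB [N [N0 hN]]].
apply/bounded_opP; split=> [a x y|]; first by rewrite /= lB lA.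
exists (M * N); split=> [|x /=]; first exact: mulr_gt0.
by apply: le_trans (hM _) _; rewrite -mulrA ler_pM2l.
Qed.

(** Riesz is applied to the real functional [rip (T h) y]; testing at ['i *: x] supplies the
    imaginary part. The bound M passes to S by |Sy|^2 = <T(Sy),y> <= M |Sy| |y|. *)
Lemma adjoint_ex T : bounded_operator T -> exists S,
  bounded_operator S /\ forall x y, inner (T x) y = inner x (S y).
Proof.
move=> /bounded_opP[lT [M [M0 hM]]].
have /choice[S hS] : forall y, exists w, forall h, rip (T h) y = rip h w.
  move=> y; apply: (@riesz (fun h => rip (T h) y) (M * nm y)) => [u v|a u|u].
  - by rewrite linD // ripDl.
  - by rewrite linZ // ripZl.
  - apply: le_trans (rip_le _ _) _.
    by rewrite mulrAC ler_wpM2r ?nm_ge0.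
have SE x y : inner (T x) y = inner x (S y).
  have h1 := hS y x; have := hS y ('i *: x).
  rewrite linZ // !ripil => /oppr_inj h2.
  move: h1 h2; rewrite /rip.
  by case: (inner (T x) y) => a b; case: (inner x (S y)) => c d /= -> ->.
exists S; split=> //; apply/bounded_opP; split.
  move=> a x y; apply: rip_ext => z.
  by rewrite /rip -SE !(linearDr, linearZr_LR) /= !SE.
exists M; split=> // y.
have [->|h] := eqVneq (nm (S y)) 0; first by rewrite mulr_ge0 ?nm_ge0 ?ltW.
have hp : 0 < nm (S y) by rewrite lt_def h nm_ge0.
rewrite -(ler_pM2l hp) -expr2 nm_sqr -hS.
apply: le_trans (rip_le _ _) _.
by rewrite mulrA (mulrC (nm (S y))) ler_wpM2r ?nm_ge0.
Qed.

Lemma adjointP T : bounded_operator T ->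
  bounded_operator (adjoint T) /\ forall x y, inner (T x) y = inner x (adjoint T y).
Proof.
move=> /adjoint_ex[S hS].
exact: (@xgetPex _ 0 [set S | _]%classic (ex_intro _ S hS)).
Qed.

Lemma rip_adjoint T x y : bounded_operator T -> rip (T x) y = rip x (adjoint T y).
Proof. by move=> /adjointP[_ h]; rewrite /rip h. Qed.

Lemma adjointK T : bounded_operator T -> adjoint (adjoint T) = T.
Proof.
move=> bT; have [bS _] := adjointP T bT.
apply/funext => x; apply: rip_ext => z.
by rewrite -rip_adjoint // ripC -rip_adjoint // ripC.
Qed.

Lemma pos_adjoint_comp T : bounded_operator T -> positive_operator (adjoint T \o T).
Proof.
move=> bT; have [bS _] := adjointP T bT.
apply/positive_opP; split=> [|x y|x] /=.
- exact: bounded_comp.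
- by rewrite ripC -!rip_adjoint // ripC.
- by rewrite ripC -rip_adjoint // -nm_sqr sqr_ge0.
Qed.

(** * The square root iteration and its limit *)

Lemma nmZc (a : R[i]) x : nm (a *: x) = cmod a * nm x.
Proof.
apply: complexI; rewrite rmorphM /= -!nmE normrZ; congr (_ * _).
Qed.

Lemma lim_unique (u : nat -> H) l l' (c c' : R) :
  (forall n, nm (l - u n) <= c / n.+1%:R) ->
  (forall n, nm (l' - u n) <= c' / n.+1%:R) -> l = l'.
Proof.
move=> hl hl'; apply/eqP; rewrite -subr_eq0; apply/eqP/nm0_eq0/eqP.
rewrite eq_le nm_ge0 andbT; apply: (@le_of_archi _ _ (c + c')) => n.
have -> : l - l' = (l - u n) + (u n - l') by rewrite addrA subrK.
rewrite add0r mulrDl; apply: le_trans (nmD _ _) _; rewrite lerD ?hl //.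
by rewrite nmB.
Qed.

(* The limit Y solves Y = (K + Y^2)/2, that is (1 - Y)^2 = 1 - K. *)
Fixpoint sqrt_iter (K : H -> H) n x : H :=
  if n is m.+1 then 2^-1%:C *: (K x + sqrt_iter K m (sqrt_iter K m x)) else 0.

(* [1 - sqrt_gap n] is the same iteration for the scalar K = 1; it majorizes the
   operator iteration and its increments. *)
Fixpoint sqrt_gap n : R := if n is m.+1 then sqrt_gap m - sqrt_gap m ^+ 2 / 2 else 1.

(** The map d - d^2/2 is increasing on [0,1], and at d = 2/k its value 2/k - 2/k^2 is at most
    2/(k+1), since its product with k + 1 is 2 - 2/k^2. *)
Lemma sqrt_gap_bound n : 0 <= sqrt_gap n <= 2 / n.+2%:R.
Proof.
elim: n => [|n /andP[h0 h1]]; first by rewrite /= divff ?pnatr_eq0 ?ler01 ?lexx.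
have p : 0 < n.+2%:R :> R by rewrite ltr0n.
have q : 0 < n.+3%:R :> R by rewrite ltr0n.
have hq : n.+3%:R = n.+2%:R + 1 :> R by rewrite -natr1.
have p2 : 2 <= n.+2%:R :> R by rewrite ler_nat.
have le1 : 2 / n.+2%:R <= 1 :> R by rewrite ler_pdivrMr // mul1r.
rewrite [sqrt_gap _.+1]/=; move: (sqrt_gap n) h0 h1 => d h0 h1.
have : 0 <= d - d ^+ 2 / 2 <= 2 / n.+2%:R - (2 / n.+2%:R) ^+ 2 / 2.
  by move: h1 le1; move: (2 / n.+2%:R) => e h1 le1; apply/andP; split; nra.
case/andP=> -> /= /le_trans; apply; move: p q p2 {h1 le1}.
rewrite hq; move: (n.+2%:R : R) => k p q p2.
rewrite ler_pdivlMr //.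
have -> : (2 / k - (2 / k) ^+ 2 / 2) * (k + 1) = 2 - 2 / k ^+ 2 by field; lra.
by rewrite gerBl divr_ge0 ?sqr_ge0.
Qed.

Section SqrtIter.
Variables (K : H -> H) (lK : linear K) (cK : forall x, nm (K x) <= nm x).

Lemma sqrt_iter_linear n : linear (sqrt_iter K n).
Proof.
elim: n => [|n IH] a x y /=; first by rewrite scaler0 addr0.
rewrite lK !IH [RHS]addrC scalerA mulrC -scalerA -scalerDr; congr (_ *: _).
by rewrite [RHS]addrC scalerDr addrACA.
Qed.

(** The induction step is (1 + (1 - d)^2)/2 = 1 - (d - d^2/2). *)
Lemma sqrt_iter_nm n x : nm (sqrt_iter K n x) <= (1 - sqrt_gap n) * nm x.
Proof.
elim: n x => [|n IH] x /=; first by rewrite subrr mul0r nm0.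
rewrite nmZ ger0_norm ?invr_ge0 //.
have /andP[d0 _] := sqrt_gap_bound n.
have := nmD (K x) (sqrt_iter K n (sqrt_iter K n x)).
have := cK x; have := IH x; have := IH (sqrt_iter K n x).
have := nm_ge0 (sqrt_iter K n (sqrt_iter K n x)).
have := nm_ge0 (sqrt_iter K n x); have := nm_ge0 x.
have d1 : sqrt_gap n <= 1.
  have /andP[_ /le_trans] := sqrt_gap_bound n; apply.
  by rewrite ler_pdivrMr ?ltr0n // mul1r ler_nat.
move: d0 d1; move: (sqrt_gap n) (nm _) (nm _) (nm _) (nm _) (nm _) => d a b c e f.
nra.
Qed.

Lemma sqrt_iter_step n x :
  nm (sqrt_iter K n.+1 x - sqrt_iter K n x) <= (sqrt_gap n - sqrt_gap n.+1) * nm x.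
Proof.
elim: n x => [|n IH] x.
  rewrite /= subr0 addr0 nmZ ger0_norm ?invr_ge0 //.
  by have := cK x; lra.
(* With X, X' two consecutive iterates, X'^2 - X^2 = X'(X' - X) + (X' - X)X, an identity free of
   commutation. *)
have -> : sqrt_iter K n.+2 x - sqrt_iter K n.+1 x = 2^-1%:C *:
   (sqrt_iter K n.+1 (sqrt_iter K n.+1 x - sqrt_iter K n x) +
    (sqrt_iter K n.+1 (sqrt_iter K n x) - sqrt_iter K n (sqrt_iter K n x))).
  rewrite (linB _ (sqrt_iter_linear _)) addrA subrK.
  by rewrite [LHS]/= -scalerBr opprD addrACA subrr add0r.
rewrite nmZ ger0_norm ?invr_ge0 //.
set a := sqrt_iter K n.+1 x - sqrt_iter K n x.
have := nmD (sqrt_iter K n.+1 a)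
  (sqrt_iter K n.+1 (sqrt_iter K n x) - sqrt_iter K n (sqrt_iter K n x)).
have := sqrt_iter_nm n.+1 a; have := IH x; rewrite -/a.
have := IH (sqrt_iter K n x); have := sqrt_iter_nm n x.
rewrite [sqrt_gap n.+2]/= -/(sqrt_gap n.+1).
have /andP[d0 _] := sqrt_gap_bound n.
have : 0 <= sqrt_gap n - sqrt_gap n.+1.
  by rewrite /= opprB addrC subrK divr_ge0 ?sqr_ge0.
have e1 : 0 <= 1 - sqrt_gap n.+1.
  rewrite subr_ge0; have /andP[_ /le_trans] := sqrt_gap_bound n.+1; apply.
  by rewrite ler_pdivrMr ?ltr0n // mul1r ler_nat.
have defg : sqrt_gap n.+1 = sqrt_gap n - sqrt_gap n ^+ 2 / 2 by [].
move: d0 e1 defg (nm_ge0 x) (nm_ge0 a) (nm_ge0 (sqrt_iter K n x)).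
move: (sqrt_gap n.+1) (sqrt_gap n) => e d.
move: (nm _) (nm _) (nm _) (nm _) (nm _) (nm _) => p q r s t u.
move=> d0 e1 de u0 t0 s0 ed hs hr ht hq hp.
have h1 := le_trans hq (ler_wpM2l e1 ht).
have h2 := le_trans hr (ler_wpM2l ed hs).
have -> : (e - (e - e ^+ 2 / 2)) * u =
  2^-1 * ((1 - e) * ((d - e) * u) + (d - e) * ((1 - d) * u)).
  by rewrite de; field.
by rewrite ler_pM2l ?invr_gt0 //; apply: le_trans hp (lerD h1 h2).
Qed.

Lemma sqrt_iter_cauchy n m x : (n <= m)%N ->
  nm (sqrt_iter K m x - sqrt_iter K n x) <= (sqrt_gap n - sqrt_gap m) * nm x.
Proof.
move=> /subnK <-; elim: (m - n)%N => [|k IH]; first by rewrite add0n !subrr mul0r nm0.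
have -> : sqrt_iter K (k.+1 + n) x - sqrt_iter K n x =
  (sqrt_iter K (k + n).+1 x - sqrt_iter K (k + n) x) + (sqrt_iter K (k + n) x - sqrt_iter K n x).
  by rewrite addrA subrK.
apply: le_trans (nmD _ _) _.
have -> : sqrt_gap n - sqrt_gap (k.+1 + n) =
  (sqrt_gap (k + n) - sqrt_gap (k + n).+1) + (sqrt_gap n - sqrt_gap (k + n)).
  by rewrite addSn; ring.
by rewrite mulrDl lerD // sqrt_iter_step.
Qed.
End SqrtIter.

(** The limit is chosen separately at each vector; linearity comes back from uniqueness of
    limits. *)
Definition sqrt_lim (K : H -> H) x : H :=
  xget 0 [set l | forall n, nm (l - sqrt_iter K n x) <= 2 * nm x / n.+1%:R]%classic.

Section SqrtLim.
Variables (K : H -> H) (lK : linear K) (cK : forall x, nm (K x) <= nm x).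

Lemma sqrt_limP x n : nm (sqrt_lim K x - sqrt_iter K n x) <= 2 * nm x / n.+1%:R.
Proof.
have [l hl] : exists l, forall n, nm (l - sqrt_iter K n x) <= 2 * nm x / n.+1%:R.
  apply: cauchy_rate_lim => k m km; apply: le_trans (sqrt_iter_cauchy K lK cK _ _ _ km) _.
  rewrite mulrAC ler_wpM2r ?nm_ge0 //.
  have /andP[_ h] := sqrt_gap_bound k; have /andP[h' _] := sqrt_gap_bound m.
  apply: (@le_trans _ _ (sqrt_gap k)); first by rewrite gerBl.
  by apply: le_trans h _; rewrite ler_pM2l // lef_pV2 ?posrE ?ltr0n // ler_nat.
exact: (@xgetPex _ 0 [set l | forall n, nm (l - sqrt_iter K n x) <= 2 * nm x / n.+1%:R]%classic
  (ex_intro _ l hl) n).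
Qed.

Lemma sqrt_iter_contr n x : nm (sqrt_iter K n x) <= nm x.
Proof.
apply: le_trans (sqrt_iter_nm _ cK _ _) _; rewrite ler_piMl ?nm_ge0 //.
by rewrite gerBl; have /andP[] := sqrt_gap_bound n.
Qed.

Lemma sqrt_lim_nm x : nm (sqrt_lim K x) <= nm x.
Proof.
apply: (@le_of_archi _ _ (2 * nm x)) => n.
have -> : sqrt_lim K x = sqrt_iter K n x + (sqrt_lim K x - sqrt_iter K n x).
  by rewrite addrC subrK.
apply: le_trans (nmD _ _) _; exact: lerD (sqrt_iter_contr _ _) (sqrt_limP _ _).
Qed.

Lemma sqrt_lim_linear : linear (sqrt_lim K).
Proof.
move=> a x y.
apply: (@lim_unique (fun n => sqrt_iter K n (a *: x + y)) _ _
   (2 * nm (a *: x + y)) (cmod a * (2 * nm x) + 2 * nm y)) => n; first exact: sqrt_limP.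
rewrite sqrt_iter_linear // opprD addrACA -scalerBr.
apply: le_trans (nmD _ _) _; rewrite nmZc mulrDl lerD ?sqrt_limP //.
by rewrite -mulrA ler_wpM2l ?sqrt_limP // cmod_ge0.
Qed.

(** Both sides are limits of the shifted sequence [sqrt_iter K n.+1 x]; the nested term converges
    because every iterate is a contraction. *)
Lemma sqrt_lim_fix x :
  sqrt_lim K x = 2^-1%:C *: (K x + sqrt_lim K (sqrt_lim K x)).
Proof.
apply: (@lim_unique (fun n => sqrt_iter K n.+1 x) _ _ (2 * nm x) (2 * nm x)) => n.
  apply: le_trans (sqrt_limP _ _) _; rewrite ler_wpM2l ?mulr_ge0 ?nm_ge0 //.
  by rewrite lef_pV2 ?posrE ?ltr0n // ler_nat.
rewrite [sqrt_iter _ _ _]/= -scalerBr opprD addrACA subrr add0r nmZ.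
rewrite ger0_norm ?invr_ge0 //.
set y := sqrt_lim K x.
have -> : sqrt_lim K y - sqrt_iter K n (sqrt_iter K n x) =
  (sqrt_lim K y - sqrt_iter K n y) + sqrt_iter K n (y - sqrt_iter K n x).
  by rewrite (linB _ (sqrt_iter_linear K lK n)) addrA subrK.
have := nmD (sqrt_lim K y - sqrt_iter K n y) (sqrt_iter K n (y - sqrt_iter K n x)).
have := sqrt_limP y n; have := le_trans (sqrt_iter_contr n _) (sqrt_limP x n).
have : 2 * nm y / n.+1%:R <= 2 * nm x / n.+1%:R.
  by rewrite ler_wpM2r ?invr_ge0 // ler_wpM2l // sqrt_lim_nm.
rewrite -/y; move: (2 * nm x / _) (2 * nm y / _) => a b; lra.
Qed.

Lemma sqrt_lim_sym : sym K -> sym (sqrt_lim K).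
Proof.
move=> sK.
have si n : sym (sqrt_iter K n).
  elim: n => [|n IH] x y /=; first by rewrite -(scale0r 0) !ripE !mul0r.
  by rewrite !ripE sK !IH.
(* One inequality suffices: exchanging x and y gives the other. *)
have le x y : rip (sqrt_lim K x) y <= rip x (sqrt_lim K y).
  apply: (@le_of_archi _ _ (4 * (nm x * nm y))) => n.
  have := rip_le (sqrt_lim K x - sqrt_iter K n x) y.
  have := rip_le x (sqrt_iter K n y - sqrt_lim K y).
  rewrite (nmB (sqrt_iter _ _ _)) !ripE si.
  have := ler_wpM2r (nm_ge0 y) (sqrt_limP x n).
  have := ler_wpM2l (nm_ge0 x) (sqrt_limP y n).
  move: (n.+1%:R^-1) => k; lra.
by move=> x y; apply/eqP; rewrite eq_le le ripC (ripC _ y) le.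
Qed.

End SqrtLim.

Lemma sqrt_lim_intertwine (K K' : H -> H) T :
  linear K -> (forall x, nm (K x) <= nm x) ->
  linear K' -> (forall x, nm (K' x) <= nm x) -> bounded_operator T ->
  (forall x, T (K x) = K' (T x)) ->
  forall x, T (sqrt_lim K x) = sqrt_lim K' (T x).
Proof.
move=> lK cK lK' cK' /bounded_opP[lT [M [M0 hM]]] hT x.
have ti n : T (sqrt_iter K n x) = sqrt_iter K' n (T x).
  elim: n x => [|n IH] z /=; first exact: lin0.
  by rewrite linZ // linD // hT !IH.
apply: (@lim_unique (fun n => T (sqrt_iter K n x)) _ _ (M * (2 * nm x)) (2 * nm (T x))) => n.
  by rewrite -linB // -mulrA; apply: le_trans (hM _) _; rewrite ler_pM2l // sqrt_limP.
by rewrite ti; exact: sqrt_limP.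
Qed.

(** * Existence and uniqueness of positive square roots *)

Definition scaled_compl (M : R) (P : H -> H) x : H := x - M^-1%:C *: P x.

(** For K = 1 - P/M the limit Y satisfies (1 - Y)^2 = P/M, whence the factor sqrt M. *)
Definition psqrt (M : R) (P : H -> H) x : H :=
  (Num.sqrt M)%:C *: (x - sqrt_lim (scaled_compl M P) x).

Lemma scaled_compl_linear (M : R) P : linear P -> linear (scaled_compl M P).
Proof.
move=> lP a x y; rewrite /scaled_compl lP scalerDr opprD addrACA scalerBr.
congr (_ - _ + _); rewrite !scalerA. by rewrite mulrC.
Qed.

Section PSqrt.
Variables (M : R) (P : H -> H).
Hypotheses (M0 : 0 < M) (pP : positive_operator P) (hM : forall x, nm (P x) <= M * nm x).
Let K := scaled_compl M P.

Let lP : linear P. Proof. by case: pP => [[]]. Qed.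
Let sP : sym P. Proof. by have /positive_opP[] := pP. Qed.
Let gP x : 0 <= rip (P x) x. Proof. by have /positive_opP[] := pP. Qed.

Lemma scaled_compl_sym : sym K.
Proof. by move=> x y; rewrite /K /scaled_compl !ripE sP. Qed.

Lemma scaled_compl_ge0 x : 0 <= rip (K x) x.
Proof.
rewrite /K /scaled_compl !ripE subr_ge0 mulrC ler_pdivrMr // mulrC -nm_sqr.
by apply: le_trans (rip_le _ _) _; rewrite expr2 mulrA ler_wpM2r ?nm_ge0.
Qed.

(** K^2 <= K because 0 <= K <= 1: Cauchy-Schwarz for <K.,.> at x and Kx gives |Kx|^4 <= <Kx,x>
    <K(Kx),Kx> <= <Kx,x> |Kx|^2. *)
Lemma scaled_compl_sqr x : nm (K x) ^+ 2 <= rip (K x) x.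
Proof.
have lK : linear K by exact: scaled_compl_linear.
have le1 y : rip (K y) y <= nm y ^+ 2.
  by rewrite /K /scaled_compl !ripE -nm_sqr gerBl mulr_ge0 // invr_ge0 ltW.
have := pos_cs K x (K x) lK scaled_compl_sym scaled_compl_ge0.
have := ler_wpM2l (scaled_compl_ge0 x) (le1 (K x)).
move=> h1 /le_trans /(_ h1); rewrite -nm_sqr expr2.
have [->|h] := eqVneq (nm (K x)) 0; first by rewrite expr0n scaled_compl_ge0.
by rewrite ler_pM2r // exprn_gt0 // lt_def h nm_ge0.
Qed.

Lemma scaled_compl_nm x : nm (K x) <= nm x.
Proof.
have := le_trans (scaled_compl_sqr x) (rip_le _ _).
have [->|h] := eqVneq (nm (K x)) 0; first by rewrite nm_ge0.
by rewrite expr2 ler_pM2l // lt_def h nm_ge0.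
Qed.

Let lK : linear K. Proof. exact: scaled_compl_linear. Qed.
Let cK := scaled_compl_nm.

Lemma psqrt_sqr x : psqrt M P (psqrt M P x) = P x.
Proof.
rewrite /psqrt -/K (linZ _ (sqrt_lim_linear K lK cK)) -scalerBr scalerA.
rewrite -rmorphM -expr2 sqr_sqrtr ?ltW // (linB _ (sqrt_lim_linear K lK cK)).
set y := sqrt_lim K x; set z := sqrt_lim K y.
(* The fixed point equation reads 2y = Kx + z, so x - 2y + z = x - Kx = Px/M. *)
have hy : y + y = K x + z.
  rewrite {1 2}/y (sqrt_lim_fix K lK cK x) -/y -/z -scalerDl -rmorphD.
  have -> : 2^-1 + 2^-1 = 1 :> R by lra.
  by rewrite scale1r.
have -> : x - y - (y - z) = M^-1%:C *: P x.
  have -> : z = y + y - K x by rewrite hy addrC addKr.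
  rewrite opprB [_ - K x - y]addrAC addrK addrA subrK.
  by rewrite /K /scaled_compl opprB addrC subrK.
by rewrite scalerA -rmorphM divff ?gt_eqF // scale1r.
Qed.

Lemma psqrt_pos : positive_operator (psqrt M P).
Proof.
have lY := sqrt_lim_linear K lK cK.
apply/positive_opP; split.
- apply/bounded_opP; split=> [a x y|].
    rewrite /psqrt -/K lY opprD addrACA -scalerBr scalerDr !scalerA.
    by rewrite [_%:C * _]mulrC.
  exists (Num.sqrt M * 2); split=> [|x]; first by rewrite mulr_gt0 ?sqrtr_gt0.
  rewrite /psqrt -/K nmZ ger0_norm ?sqrtr_ge0 // -mulrA ler_wpM2l ?sqrtr_ge0 //.
  apply: le_trans (nmD _ _) _; rewrite nmN.
  by have := sqrt_lim_nm K lK cK x; lra.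
- move=> x y; rewrite /psqrt -/K !ripE (sqrt_lim_sym K lK cK) //; exact: scaled_compl_sym.
- move=> x; rewrite /psqrt -/K !ripE mulr_ge0 ?sqrtr_ge0 // -nm_sqr subr_ge0 expr2.
  apply: le_trans (rip_le _ _) _.
  by rewrite ler_wpM2r ?nm_ge0 // sqrt_lim_nm.
Qed.

End PSqrt.

Lemma psqrt_intertwine (M : R) P Q T : 0 < M ->
  positive_operator P -> positive_operator Q ->
  (forall x, nm (P x) <= M * nm x) -> (forall x, nm (Q x) <= M * nm x) ->
  bounded_operator T -> (forall x, T (P x) = Q (T x)) ->
  forall x, T (psqrt M P x) = psqrt M Q (T x).
Proof.
move=> M0 pP pQ hP hQ bT hT x; have lT := bT.1.
rewrite /psqrt linZ // linB // (sqrt_lim_intertwine _ (scaled_compl M Q)) //.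
- by apply: scaled_compl_linear; exact: pP.1.1.
- exact: scaled_compl_nm.
- by apply: scaled_compl_linear; exact: pQ.1.1.
- exact: scaled_compl_nm.
- by move=> y; rewrite /scaled_compl linB // linZ // hT.
Qed.

Lemma pos_eq0 A y : positive_operator A -> rip (A y) y = 0 -> A y = 0.
Proof.
move=> /positive_opP[[lA _] sA gA] h; apply: nm0_eq0; apply/eqP.
rewrite -sqrf_eq0 nm_sqr -sqrf_eq0 eq_le sqr_ge0 andbT.
by apply: le_trans (pos_cs A _ _ lA sA gA) _; rewrite h mul0r.
Qed.

(** B commutes with P = B^2, hence with C. For y = (B - C)x this gives (B + C)y = 0, so both
    nonnegative terms <By,y> and <Cy,y> vanish, By = Cy = 0, and |y|^2 = <x,(B - C)y> = 0. *)
Lemma psqrt_unique (M : R) P B : 0 < M -> positive_operator P ->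
  (forall x, nm (P x) <= M * nm x) -> positive_operator B -> B \o B = P ->
  B = psqrt M P.
Proof.
move=> M0 pP hP pB BB.
have BE x : B (B x) = P x by rewrite -BB.
set C := psqrt M P.
have pC : positive_operator C by exact: psqrt_pos.
have CE x : C (C x) = P x by exact: psqrt_sqr.
have BC x : B (C x) = C (B x).
  apply: psqrt_intertwine => //; first exact: pB.1.
  by move=> z; rewrite -!BE.
have /positive_opP[[lB _] sB gB] := pB; have /positive_opP[[lC _] sC gC] := pC.
apply/funext => x; apply/eqP; rewrite -subr_eq0; set y := B x - C x.
have h : B y + C y = 0.
  by rewrite /y (linB _ lB) (linB _ lC) BE CE BC addrA subrK subrr.
have h0 : rip (B y) y + rip (C y) y = 0 by rewrite -ripDl h -(scale0r 0) ripZl mul0r.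
have By : B y = 0 by apply: pos_eq0 => //; have := gB y; have := gC y; lra.
have Cy : C y = 0 by move: h; rewrite By add0r.
apply/eqP/nm0_eq0/eqP; rewrite -sqrf_eq0 nm_sqr {1}/y.
rewrite ripDl ripNl sB sC By Cy -(scale0r 0) ripZr mul0r subrr //.
Qed.

(** Any admissible M yields the same root, so one M can serve two operators at once. *)
Lemma sqrt_operatorE (M : R) P : 0 < M -> positive_operator P ->
  (forall x, nm (P x) <= M * nm x) -> sqrt_operator P = psqrt M P.
Proof.
move=> M0 pP hP; rewrite /sqrt_operator.
apply: xget_unique.
  split; first exact: psqrt_pos.
  by apply/funext => x; exact: psqrt_sqr.
by move=> B [pB BB]; exact: psqrt_unique.
Qed.

(** * Linear combinations and absolute values of operators *)

Lemma bounded_lincomb (a b : R[i]) A B : bounded_operator A -> bounded_operator B ->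
  bounded_operator (a *: A + b *: B).
Proof.
move=> /bounded_opP[lA [M [M0 hM]]] /bounded_opP[lB [N [N0 hN]]].
apply/bounded_opP; split=> [c x y|].
  rewrite /= !fctE lA lB !scalerDr addrACA !scalerA.
  by rewrite ![c * _]mulrC.
(* The summand 1 keeps the bound strictly positive when a = b = 0. *)
exists (1 + cmod a * M + cmod b * N); split=> [|x].
  by rewrite -addrA ltr_pwDl // addr_ge0 // mulr_ge0 ?cmod_ge0 // ltW.
rewrite /= !fctE 2!mulrDl mul1r -addrA; apply: le_trans (nmD _ _) _.
apply: ler_wpDl; first exact: nm_ge0.
by rewrite lerD // nmZc -mulrA ler_wpM2l ?cmod_ge0.
Qed.

(** [psqrt_intertwine] compares two roots built with the same M, so a common bound for both products
    of T and its adjoint is prepared. *)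
Lemma abs_bound T : bounded_operator T ->
  exists M : R, [/\ 0 < M, forall x, nm (adjoint T (T x)) <= M * nm x &
                    forall x, nm (T (adjoint T x)) <= M * nm x].
Proof.
move=> bT; have [bS _] := adjointP T bT.
have /bounded_opP[_ [M [M0 hM]]] := bounded_comp _ _ bS bT.
have /bounded_opP[_ [N [N0 hN]]] := bounded_comp _ _ bT bS.
exists (M + N); split=> [|x|x]; first exact: addr_gt0.
- by apply: le_trans (hM x) _; rewrite ler_wpM2r ?nm_ge0 // lerDl ltW.
- by apply: le_trans (hN x) _; rewrite ler_wpM2r ?nm_ge0 // lerDr ltW.
Qed.

Lemma abs_pos T : bounded_operator T -> positive_operator (abs_operator T).
Proof.
move=> bT; have [M [M0 hM _]] := abs_bound T bT.
rewrite /abs_operator (sqrt_operatorE M) //; last exact: pos_adjoint_comp.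
by apply: psqrt_pos => //; exact: pos_adjoint_comp.
Qed.

Lemma abs_sqr T x : bounded_operator T ->
  abs_operator T (abs_operator T x) = adjoint T (T x).
Proof.
move=> bT; have [M [M0 hM _]] := abs_bound T bT.
rewrite /abs_operator (sqrt_operatorE M) //; last exact: pos_adjoint_comp.
by rewrite psqrt_sqr //; exact: pos_adjoint_comp.
Qed.

Lemma abs_intertwine T x : bounded_operator T ->
  T (abs_operator T x) = abs_operator (adjoint T) (T x).
Proof.
move=> bT; have [M [M0 hM hN]] := abs_bound T bT.
have [bS _] := adjointP T bT.
have p1 := pos_adjoint_comp T bT; have p2 := pos_adjoint_comp _ bS.
move: p2; rewrite /abs_operator adjointK // => p2.
rewrite !(sqrt_operatorE M) //.
exact: psqrt_intertwine.
Qed.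

Lemma nm_abs T x : bounded_operator T -> nm (abs_operator T x) = nm (T x).
Proof.
move=> bT; have /positive_opP[_ sA _] := abs_pos T bT.
apply/eqP; rewrite -(@eqrXn2 _ 2) ?nm_ge0 // !nm_sqr sA abs_sqr //.
by rewrite -rip_adjoint.
Qed.

(** * The mixed Schwarz inequality *)

(* The vectors (1 - A/M)^n x differ from x by elements of the range of A, while
   A (1 - A/M)^n tends to 0. *)
Lemma range_approx A x : positive_operator A -> exists c : R, forall n, exists u,
  nm (x - A u) <= nm x /\ nm (A (x - A u)) ^+ 2 <= c / n.+1%:R.
Proof.
move=> pA; have /positive_opP[/bounded_opP[lA [M [M0 hM]]] _ _] := pA.
pose K := scaled_compl M A.
have lK : linear K by exact: scaled_compl_linear.
have cK := scaled_compl_nm M A M0 pA hM.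
pose v n := iter n K x.
have wE z : z - K z = M^-1%:C *: A z by rewrite /K /scaled_compl opprB addrC subrK.
have vx n : nm (v n) <= nm x.
  by elim: n => //= n IH; apply: le_trans (cK _) IH.
have vu n : exists u, x - A u = v n.
  elim: n => [|n [u hu]]; first by exists 0; rewrite lin0 // subr0.
  exists (u + M^-1%:C *: v n); rewrite linD // linZ // -wE opprD addrA hu.
  by rewrite opprB addrC subrK.
(* K^2 <= K gives |z - Kz|^2 + |Kz|^2 <= |z|^2. The increments of v do not increase, as K is a
   contraction, so n + 1 copies of the last one fit below |x|^2. Since A(v n) = M(v n - v n.+1),
   this bounds A(v n). *)
have dec n : n.+1%:R * nm (v n - v n.+1) ^+ 2 + nm (v n.+1) ^+ 2 <= nm x ^+ 2.
  have drop z : nm (z - K z) ^+ 2 + nm (K z) ^+ 2 <= nm z ^+ 2.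
    have := scaled_compl_sqr M A M0 pA hM z; rewrite -/K.
    rewrite !nm_sqr; move: (K z) => w.
    by rewrite !ripE (ripC z w); lra.
  elim: n => [|n IH]; first by rewrite mul1r; exact: drop.
  apply: le_trans IH; have := drop (v n.+1); rewrite -/(v n.+2).
  have : nm (v n.+1 - v n.+2) ^+ 2 <= nm (v n - v n.+1) ^+ 2.
    by rewrite ler_pXn2r ?nnegrE ?nm_ge0 // -(linB K lK).
  have : 1 <= n.+1%:R :> R by rewrite ler1n.
  rewrite -(natr1 n.+1); nra.
exists (M ^+ 2 * nm x ^+ 2) => n; have [u hu] := vu n; exists u; rewrite hu.
split=> //; rewrite ler_pdivlMr ?ltr0n //.
have -> : A (v n) = M%:C *: (v n - v n.+1).
  by rewrite wE scalerA -rmorphM divff ?gt_eqF // scale1r.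
rewrite nmZ (ger0_norm (ltW M0)) exprMn -mulrA ler_wpM2l ?sqr_ge0 //.
have := dec n; rewrite mulrC; have := sqr_ge0 (nm (v n.+1)); lra.
Qed.

Lemma mixed_schwarz_re T x y : bounded_operator T ->
  rip (T x) y ^+ 2 <= rip (abs_operator T x) x * rip (abs_operator (adjoint T) y) y.
Proof.
move=> bT; have [bS _] := adjointP T bT.
have pA := abs_pos T bT; have pB := abs_pos _ bS.
have hT z := nm_abs T z bT; have hI z := abs_intertwine T z bT.
have hS z := abs_sqr T z bT.
move: pA pB hT hI hS; set A := abs_operator T; set B := abs_operator _.
move=> pA pB hT hI hS.
have /positive_opP[[lA _] sA gA] := pA; have /positive_opP[[lB _] sB gB] := pB.
(* As TA = BT, Cauchy-Schwarz for <B.,.> applies at Tu and y, with <B(Tu),Tu> = <T(Au),Tu> =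
   <Au,A(Au)>. *)
have ran u : rip (T (A u)) y ^+ 2 <= rip (A (A u)) (A u) * rip (B y) y.
  rewrite hI; apply: le_trans (pos_cs B _ _ lB sB gB) _.
  by rewrite -hI rip_adjoint // -hS ripC.
have [c hc] := range_approx A x pA.
have step n : exists u, nm (x - A u) <= nm x /\ nm (A (x - A u)) <= n.+1%:R^-1.
  have : 0 < (n.+1%:R^-1 : R) ^+ 2 by rewrite exprn_gt0 // invr_gt0.
  move=> /(archi_lt c)[m hm]; have [u [h1 h2]] := hc m; exists u; split=> //.
  have := le_trans h2 (ltW hm).
  by rewrite ler_pXn2r ?nnegrE ?nm_ge0 ?invr_ge0.
(* For v = x - Au, |v| <= |x| and |Av| <= 1/(n+1): expanding <A(x - v),x - v> costs 3|x|/(n+1), and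
   the cross term of (<Tx,y> - <Tv,y>)^2 costs the rest, because |Tv| = |Av|. *)
apply: (@le_of_archi _ _ (3 * nm x * rip (B y) y + 2 * `|rip (T x) y| * nm y)) => n.
have [u [h1 h2]] := step n; have hr := ran u.
have [v hv] : exists v, v = x - A u by exists (x - A u).
rewrite -hv in h1 h2.
have Au : A u = x - v by rewrite hv opprB addrC subrK.
have e1 : rip (A (A u)) (A u) <= rip (A x) x + 3 * nm x * n.+1%:R^-1.
  rewrite Au linB // !ripE (sA x v) (ripC x).
  have := rip_le (- A v) x; have := rip_le (A v) v; rewrite nmN ripNl.
  have := ler_pM (nm_ge0 _) (nm_ge0 _) h2 h1.
  have := ler_wpM2r (nm_ge0 x) h2.
  move: (n.+1%:R^-1) => k; lra.
have e2 : `|rip (T v) y| <= nm y * n.+1%:R^-1.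
  have : nm (T v) * nm y <= nm y * n.+1%:R^-1 by rewrite -hT mulrC ler_wpM2l ?nm_ge0.
  apply: le_trans; rewrite ler_norml rip_le andbT lerNl -ripNl.
  by apply: le_trans (rip_le _ _) _; rewrite nmN.
have e3 : rip (T (A u)) y = rip (T x) y - rip (T v) y.
  by rewrite Au (linB _ bT.1) !ripE.
have e4 := le_trans hr (ler_wpM2r (gB y) e1).
have e5 : 2 * (rip (T x) y * rip (T v) y) <= 2 * (`|rip (T x) y| * (nm y * n.+1%:R^-1)).
  rewrite ler_pM2l //; apply: le_trans (ler_norm _) _.
  by rewrite normrM ler_wpM2l.
move: e4 e5; rewrite e3; have := sqr_ge0 (rip (T v) y).
move: (n.+1%:R^-1) => k; lra.
Qed.

Lemma inner_pos A x : positive_operator A -> inner (A x) x = (rip (A x) x)%:C.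
Proof. by case=> _ /(_ x) h; rewrite /rip RRe_real // ger0_real. Qed.

(** The phase of <Tx,y> is absorbed into y, which leaves the form of |S| at y unchanged, S being the
    adjoint of T. *)
Lemma mixed_schwarz T x y : bounded_operator T ->
  cmod (inner (T x) y) ^+ 2 <=
    rip (abs_operator T x) x * rip (abs_operator (adjoint T) y) y.
Proof.
move=> bT; have [c [hc <-]] := phase (T x) y.
have [bS _] := adjointP T bT; have [[lB _] _] := abs_pos _ bS.
apply: le_trans (mixed_schwarz_re _ _ _ bT) _.
by rewrite linZ // rip_phase.
Qed.

Lemma rip_le_cmod x y : rip x y <= cmod (inner x y).
Proof.
rewrite /rip /cmod normc_def /=; apply: le_trans (ler_norm _) _.
by rewrite -sqrtr_sqr ler_wsqrtr // lerDl sqr_ge0.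
Qed.

(** * Numerical radius and operator norm as suprema *)

Lemma sup_ge0 (E : set R) : (forall e, E e -> 0 <= e) -> 0 <= sup E.
Proof.
(* On a set without a supremum, [sup] takes the value 0. *)
move=> h; have [hE|hE] := pselect (has_sup E); last by rewrite sup_out.
by have [[e he] ub] := hE; apply: le_trans (h _ he) (ub_le_sup ub he).
Qed.

Lemma numradius_ge0 T : 0 <= numradius T.
Proof. by apply: sup_ge0 => _ [x _ <-]; exact: cmod_ge0. Qed.

Lemma opnorm_ge0 T : 0 <= opnorm T.
Proof. by apply: sup_ge0 => _ [x _ <-]; exact: nm_ge0. Qed.

Lemma unit_nm x : `|x| = 1 -> nm x = 1.
Proof. by move=> h; apply: complexI; rewrite -nmE h. Qed.

Lemma le_numradius T x : bounded_operator T -> `|x| = 1 ->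
  cmod (inner (T x) x) <= numradius T.
Proof.
move=> /bounded_opP[_ [M [_ hM]]] hx; apply: ub_le_sup; last by exists x.
exists M => _ [y /unit_nm hy <-]; apply: le_trans (cmod_le _ _) _.
by rewrite hy mulr1; have := hM y; rewrite hy mulr1.
Qed.

Lemma le_opnorm T x : bounded_operator T -> `|x| = 1 -> nm (T x) <= opnorm T.
Proof.
move=> /bounded_opP[_ [M [M0 hM]]] hx; apply: ub_le_sup; last by exists x; rewrite //= hx.
exists M => _ [y /= hy <-]; apply: le_trans (hM y) _.
by rewrite ger_pMr // -lecR -nmE.
Qed.

Lemma numradius_sqr_le T (b : R) : 0 <= b ->
  (forall x, `|x| = 1 -> cmod (inner (T x) x) ^+ 2 <= b) -> numradius T ^+ 2 <= b.
Proof.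
move=> b0 h; rewrite -[b]sqr_sqrtr // ler_pXn2r ?nnegrE ?numradius_ge0 ?sqrtr_ge0 //.
(* Without unit vectors the set is empty and its [sup] is 0; with one, the set is nonempty and
   [ge_sup] applies. *)
have [[x hx]|hn] := pselect (exists x : H, `|x| = 1); last first.
  have E0 : [set cmod (inner (T x) x) | x in [set x : H | `|x| = 1]]%classic = set0.
    by apply/seteqP; split=> // r [x hx _]; apply: hn; exists x.
  by rewrite /numradius E0 sup0 sqrtr_ge0.
apply: ge_sup; first by exists (cmod (inner (T x) x)); exists x.
move=> _ [y hy <-]; rewrite -[X in X <= _]ger0_norm ?cmod_ge0 // -sqrtr_sqr.
by rewrite ler_wsqrtr // h.
Qed.

(** * Bounds at a unit vector and the final estimate *)

Lemma numradius_cartesian A B x : positive_operator A -> positive_operator B ->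
  `|x| = 1 -> rip (A x) x ^+ 2 + rip (B x) x ^+ 2 <= numradius (A + 'i *: B) ^+ 2.
Proof.
move=> pA pB hx.
have bC : bounded_operator (A + 'i *: B).
  by rewrite -[A]scale1r; exact: (bounded_lincomb _ _ _ _ pA.1 pB.1).
have := le_numradius _ _ bC hx.
(* Both forms are real, hence they are the real and imaginary parts of <(A + iB)x,x>. *)
rewrite !fctE linearDl linearZl_LR /= !inner_pos //.
rewrite -(@ler_pXn2r _ 2) ?nnegrE ?cmod_ge0 ?numradius_ge0 //.
apply: le_trans; rewrite /cmod normc_def /= sqr_sqrtr ?addr_ge0 ?sqr_ge0 //.
by rewrite !mul0r !mul1r subr0 !addr0 !add0r.
Qed.

(* Buzano's inequality for the vectors A x, B x and the unit vector x, obtained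
   by reflecting A x across the line spanned by x. *)
Lemma buzano A B x : positive_operator A -> positive_operator B ->
  `|x| = 1 -> 2 * (rip (A x) x * rip (B x) x) <=
    numradius (A \o B) + nm (A x) * nm (B x).
Proof.
move=> pA pB hx; have /positive_opP[bA sA _] := pA.
have := le_numradius _ _ (bounded_comp _ _ bA pB.1) hx.
have := rip_le_cmod (A (B x)) x.
have := rip_le ((2 * rip (A x) x)%:C *: x - A x) (B x).
have -> : nm ((2 * rip (A x) x)%:C *: x - A x) = nm (A x).
  apply/eqP; rewrite -(@eqrXn2 _ 2) ?nm_ge0 // !nm_sqr !ripE -nm_sqr unit_nm // (ripC x).
  by apply/eqP; ring.
(* Pairing the reflected vector with Bx gives 2<Ax,x><Bx,x> - Re <Ax,Bx>, and Re <Ax,Bx> = Re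
   <ABx,x>. *)
rewrite !ripE (ripC x) (sA (B x)) (ripC (B x) (A x)) /=; lra.
Qed.

(** By symmetry of A and B the left side is <(pA^2 + qB^2)x,x>, which Cauchy-Schwarz bounds at a
    unit vector. *)
Lemma le_opnorm_sqr_comb (p q : R) A B x :
  positive_operator A -> positive_operator B -> `|x| = 1 ->
  p * nm (A x) ^+ 2 + q * nm (B x) ^+ 2 <=
    opnorm (p%:C *: (A \o A) + q%:C *: (B \o B)).
Proof.
move=> pA pB hx; have /positive_opP[bA sA _] := pA; have /positive_opP[bB sB _] := pB.
have bC := bounded_lincomb p%:C q%:C _ _ (bounded_comp _ _ bA bA) (bounded_comp _ _ bB bB).
apply: le_trans (le_opnorm _ _ bC hx).
apply: le_trans (_ : _ <= nm _ * nm x) _; last by rewrite (unit_nm x) // mulr1.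
apply: le_trans (rip_le _ _).
by rewrite !fctE /= !ripE sA sB !nm_sqr.
Qed.

Lemma numradius_pointwise T (alpha : R) x : bounded_operator T ->
  0 <= alpha <= 1 -> `|x| = 1 ->
  let absT := abs_operator T in let absTs := abs_operator (adjoint T) in
  let W := alpha / 4 * numradius (absT + 'i *: absTs) ^+ 2
    + alpha / 4 * numradius (absT \o absTs) in
  cmod (inner (T x) x) ^+ 2 <=
    W + ((1 - 7 * alpha / 8) * nm (absTs x) ^+ 2 + alpha / 8 * nm (absT x) ^+ 2) /\
  cmod (inner (T x) x) ^+ 2 <=
    W + ((1 - 7 * alpha / 8) * nm (absT x) ^+ 2 + alpha / 8 * nm (absTs x) ^+ 2).
Proof.
move=> bT /andP[a0 a1] hx absT absTs W; have [bS hS] := adjointP T bT.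
have pA := abs_pos T bT; have pB := abs_pos _ bS.
have t1 := mixed_schwarz T x x bT.
have t2 := numradius_cartesian _ _ x pA pB hx.
have t3 := buzano _ _ x pA pB hx.
have t4 : cmod (inner (T x) x) ^+ 2 <= nm (absT x) ^+ 2.
  rewrite ler_pXn2r ?nnegrE ?cmod_ge0 ?nm_ge0 // nm_abs //.
  by apply: le_trans (cmod_le _ _) _; rewrite (unit_nm x) // mulr1.
have t5 : cmod (inner (T x) x) ^+ 2 <= nm (absTs x) ^+ 2.
  rewrite ler_pXn2r ?nnegrE ?cmod_ge0 ?nm_ge0 // nm_abs // hS.
  by apply: le_trans (cmod_le _ _) _; rewrite (unit_nm x) // mul1r.
rewrite /W; move: t2 t3 t1 t4 t5; rewrite -/absT -/absTs.
move: (numradius _) (numradius _) => w' w t2 t3.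
move: (rip _ _) (rip _ _) (nm _) (nm _) (cmod _ ^+ 2) t2 t3 => b a n m t t2 t3 t1 t4 t5.
have t6 : 4 * t <= w ^+ 2 + w' + (m ^+ 2 + n ^+ 2) / 2.
  by have := sqr_ge0 (a - b); have := sqr_ge0 (m - n); lra.
(* A quarter of this puts alpha/8 on each square; adding 1 - alpha times [t5] or [t4] makes one of
   the two coefficients 1 - 7 alpha/8. *)
have := ler_wpM2l a0 t6.
have b0 : 0 <= 1 - alpha by rewrite subr_ge0.
by have := ler_wpM2l b0 t4; have := ler_wpM2l b0 t5; split; lra.
Qed.
End Operators.
Theorem corollary2p7 (R : realType) (H : hilbertType R) (T : H -> H)
    (hT : bounded_operator T) (alpha : R) (halpha : 0 <= alpha <= 1) :
  let absT : H -> H := abs_operator T in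
  let absTs : H -> H := abs_operator (adjoint T) in
  numradius T ^+ 2 <=
    alpha / 4 * numradius (absT + 'i%C *: absTs) ^+ 2
    + alpha / 4 * numradius (absT \o absTs)
    + Num.min
        (opnorm ((1 - 7 * alpha / 8)%:C *: (absTs \o absTs)
                 + (alpha / 8)%:C *: (absT \o absT)))
        (opnorm ((1 - 7 * alpha / 8)%:C *: (absT \o absT)
                 + (alpha / 8)%:C *: (absTs \o absTs))).
Proof.
lazy zeta; have [bS _] := adjointP T hT; have [a0 _] := andP halpha.
have pA := abs_pos T hT; have pB := abs_pos _ bS.
apply: numradius_sqr_le => [|x hx].
  apply: addr_ge0; last by rewrite le_min !opnorm_ge0.
  by rewrite addr_ge0 // mulr_ge0 ?divr_ge0 ?sqr_ge0 ?numradius_ge0.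
have [h1 h2] := numradius_pointwise T alpha x hT halpha hx.
rewrite -lerBlDl le_min !lerBlDl; apply/andP; split.
- by apply: le_trans h1 _; rewrite lerD2l le_opnorm_sqr_comb.
- by apply: le_trans h2 _; rewrite lerD2l le_opnorm_sqr_comb.
Qed.
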